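(* For any $\mathbf b=(b_1,b_2,\dots,b_n)\in\mathbb Z_{>0}^n$, the $\mathbf b$-parking-function polytope $\mathfrak X_n(\mathbf b)$ is combinatorially equivalent to the classical parking-function polytope $\mathsf{PF}_n$ if $b_1=1$, and is combinatorially equivalent to the stellohedron $\mathsf{St}_n$ if $b_1\ge2$.
   Context: A $\mathbf b$-parking function is a list $(\beta_1,\dots,\beta_n)$ of positive integers whose nondecreasing rearrangement $\beta'_1\le\cdots\le\beta'_n$ satisfies $\beta'_i\le b_1+\cdots+b_i$ for all $i$. The $\mathbf b$-parking-function polytope $\mathfrak X_n(\mathbf b)\subset\mathbb R^n$ is the convex hull of all $\mathbf b$-parking functions. The classical parking-function polytope $\mathsf{PF}_n$ is $\mathfrak X_n(1,1,\dots,1)$, i.e. the convex hull of all lists of $n$ positive integers whose nondecreasing rearrangement satisfies $\alpha'_i\le i$ for all $i$. For a nonempty $I\subseteq[n+1]$, let $\bigtriangleup_I=\mathrm{conv}\{\mathbf e_i:i\in I\}\subset\mathbb R^{n+1}$. For a building set $\mathcal B$ on $[n+1]$, a nestohedron for $\mathcal B$ is a Minkowski sum $\sum_{I\in\mathcal B}y_I\bigtriangleup_I$ with all $y_I>0$ (its combinatorial type does not depend on the choice of the positive parameters $y_I$). The stellohedron $\mathsf{St}_n$ is a nestohedron for the building set $\{\{1\},\{2\},\dots,\{n\}\}\cup\{T\cup\{n+1\}:T\subseteq[n]\}$. Two polytopes are combinatorially equivalent if their face lattices are isomorphic. *)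

(* Defs.v *)
From HB Require Import structures.
From mathcomp Require Import all_boot all_order all_algebra.
From mathcomp Require Import all_classical all_reals convex.

Set Implicit Arguments.
Unset Strict Implicit.
Unset Printing Implicit Defensive.

Import Order.TTheory GRing.Theory Num.Theory.

Local Open Scope classical_set_scope.
Local Open Scope ring_scope.

Section Polytopes.
Context {R : realType}.

Definition convex_hull (V : lmodType R) (A : set V) : set V :=
  smallest (fun X : set (convex_lmodType V) => convex_set X) A.

(* F is the intersection of P with {l = c} for a linear inequality l <= c
   valid on P. Both the empty face (l = 0, c = 1) and P itself (l = 0, c = 0)
   are included, so that the faces of a polytope form a lattice. *)
Definition face (V : lmodType R) (P F : set V) : Prop :=
  exists (l : {scalar V}) (c : R),
    (forall x, P x -> l x <= c) /\ F = P `&` [set x | l x = c].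

(* An isomorphism of lattices is the same as an order isomorphism, here for
   the inclusion order on faces. *)
Definition combinatorially_equivalent (V W : lmodType R)
    (P : set V) (Q : set W) : Prop :=
  exists2 f : set V -> set W,
    set_bij (face P) (face Q) f
    & forall F G, face P F -> face P G -> (f F `<=` f G <-> F `<=` G).

End Polytopes.

(* Indices are shifted to 0 .. n-1: entry i of the rearrangement is bounded by
   b_0 + ... + b_i. *)
Definition parking_function (n : nat) (b : 'I_n -> nat) (beta : n.-tuple nat) : Prop :=
  (forall i : 'I_n, 0 < tnth beta i)%N /\
  (forall i : 'I_n,
    nth 0%N (sort leq beta) i <= \sum_(j < n | (j <= i)%N) b j)%N.

Definition parking_polytope (R : realType) (n : nat) (b : 'I_n -> nat) :
    set 'rV[R]_n :=
  convex_hull [set \row_(i < n) (tnth beta i)%:R | beta in parking_function b].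

Arguments parking_polytope : clear implicits.
Arguments parking_polytope R {n} b.

Definition classical_parking_polytope (R : realType) (n : nat) :
    set 'rV[R]_n :=
  parking_polytope R (fun _ : 'I_n => 1%N).
Arguments classical_parking_polytope : clear implicits.

Section Nestohedra.
Variables (R : realType) (m : nat).

Definition simplex (I : {set 'I_m}) : set 'rV[R]_m :=
  convex_hull [set delta_mx 0 i | i in [set` I]].

(* The Minkowski sum of the y_I-dilated simplices over I in B. *)
Definition simplex_sum (B : {set {set 'I_m}}) (y : {set 'I_m} -> R) :
    set 'rV[R]_m :=
  [set x | exists2 z : {set 'I_m} -> 'rV[R]_m,
      forall I, I \in B -> simplex I (z I) &
      x = \sum_(I in B) y I *: z I].

Definition nestohedron (B : {set {set 'I_m}}) (P : set 'rV[R]_m) : Prop :=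
  exists2 y : {set 'I_m} -> R,
    forall I, I \in B -> 0 < y I & P = simplex_sum B y.

End Nestohedra.

(* The ground set [n+1] is 'I_n.+1; the distinguished element n+1 is ord_max. *)
Definition stellohedron_building_set (n : nat) : {set {set 'I_n.+1}} :=
  ([set [set i] | i in [set~ ord_max]] :|:
   [set ord_max |: T | T in powerset [set~ ord_max]])%SET.

Definition stellohedron (R : realType) (n : nat) (P : set 'rV[R]_n.+1) : Prop :=
  nestohedron (stellohedron_building_set n) P.

(* Main.v *)
(* Let F_w be the face of a polytope where the linear form with coefficients w
   is maximal.  The nonempty faces are the F_w, so two polytopes are
   combinatorially equivalent as soon as inclusion of F_w in F_w' defines the
   same preorder on linear forms for both.

   For a parking function beta, w . beta is the sum over s of the w-weights of
   the layers {i | beta_i > s}.  The layer at s may have any size up to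
   capacity(s) = #{j | b_1 + ... + b_j > s}, and a greedy chain of sets
   maximizes the weight for all sizes at once.  So beta lies in F_w iff all its
   layers (except the full one, s = 0) have maximal weight, and the preorder
   only depends on the values of the capacity at s >= 1: these are 0, ..., n-1,
   and also n if b_1 >= 2.  This gives the case b_1 = 1.

   If b_1 >= 2, the preorder compares the signs of the w_i and the order of the
   nonnegative ones.  The stellohedron gives the same preorder, since a linear
   form u is maximal on a Minkowski sum iff it is maximal on each summand, and
   maximizing u over {i, n+1} and {i, j, n+1} reads off the signs and the
   order of the nonnegative ones among the u_i - u_(n+1). *)
Require Import Defs.
From HB Require Import structures.
From mathcomp Require Import all_boot all_order all_algebra.
From mathcomp Require Import all_classical all_reals convex.

Set Implicit Arguments.
Unset Strict Implicit.
Unset Printing Implicit Defensive.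

Import Order.TTheory GRing.Theory Num.Theory.

Local Open Scope classical_set_scope.
Local Open Scope ring_scope.

(** * Linear inequalities on convex hulls *)

Section ConvexHull.
Context {R : realType} {V : lmodType R}.
Implicit Types (A X : set V) (l : {scalar V}).

Lemma convex_hull_min A X :
    (forall x y (t : R), 0 < t -> t < 1 -> X x -> X y ->
      X (t *: x + (1 - t) *: y)) ->
  A `<=` X -> convex_hull A `<=` X.
Proof.
move=> Xconv AX; apply: smallest_sub => //.
apply/convex_setW => x y /set_mem Xx /set_mem Xy k k0 k1.
exact/mem_set/Xconv.
Qed.

Lemma sub_convex_hull A : A `<=` convex_hull A.
Proof. exact: sub_smallest. Qed.

Lemma convex_hull_le A l c :
  (forall a, A a -> l a <= c) -> forall x, convex_hull A x -> l x <= c.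
Proof.
move=> Ac; apply: convex_hull_min => //= x y t t0 t1 xc yc.
rewrite linearD !linearZ/= -[c](subrK (t * c)) addrC -{1}[c]mul1r -mulrBl.
by rewrite lerD// ler_wpM2l// ?ltW// subr_gt0.
Qed.

(** Face inclusions can thus be tested on generators. The points satisfying both bounds and the
    implication form a convex set, because a proper convex combination reaches the bound [c] only if
    both endpoints do. *)
Lemma convex_hull_face_sub A l l' c c' :
    (forall a, A a -> l a <= c) -> (forall a, A a -> l' a <= c') ->
    (forall a, A a -> l a = c -> l' a = c') ->
  forall x, convex_hull A x -> l x = c -> l' x = c'.
Proof.
move=> Ac Ac' AE.
pose X := [set x | [/\ l x <= c, l' x <= c' & l x = c -> l' x = c']].
suff: convex_hull A `<=` X by move=> AX x /AX[].
apply: convex_hull_min => [x y t t0 t1|a Aa]; last by split; auto.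
move=> [xc xc' xE] [yc yc' yE].
have s0 : 0 < 1 - t by rewrite subr_gt0.
have cE d : d = t * d + (1 - t) * d by rewrite -mulrDl addrC subrK mul1r.
rewrite /X/= !linearD !linearZ/=; split.
- by rewrite [leRHS]cE lerD// ler_pM2l.
- by rewrite [leRHS]cE lerD// ler_pM2l.
have [/xE ->|xNc] := eqVneq (l x) c.
  have [/yE -> _|yNc E] := eqVneq (l y) c; first by rewrite -cE.
  suff : t * l x + (1 - t) * l y < c by rewrite E ltxx.
  by rewrite [ltRHS]cE ler_ltD// ?ler_pM2l// ltr_pM2l// lt_neqAle yNc.
move=> E; suff : t * l x + (1 - t) * l y < c by rewrite E ltxx.
by rewrite [ltRHS]cE ltr_leD// ?ler_pM2l// ltr_pM2l// lt_neqAle xNc.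
Qed.

End ConvexHull.

(** * Faces and support functions *)

Section Faces.
Context {R : realType}.

(** Several indices may give the same face, but mutual inclusion identifies the same indices on both
    sides; the empty face is matched separately. *)
Lemma combinatorially_equivalent_of_preorder (V W : lmodType R) (I : Type)
    (P : set V) (Q : set W) (FP : I -> set V) (FQ : I -> set W) :
    (forall F, face P F <-> F = set0 \/ exists i, F = FP i) ->
    (forall F, face Q F <-> F = set0 \/ exists i, F = FQ i) ->
    (forall i, FP i !=set0) -> (forall i, FQ i !=set0) ->
    (forall i j, FP i `<=` FP j <-> FQ i `<=` FQ j) ->
  combinatorially_equivalent P Q.
Proof.
move=> faceP faceQ P0 Q0 PQ.
(* The union over all indices below [F] avoids choosing an index for [F]. It sends the empty face to
   itself because no [FP i] is empty. *)
pose f F := \bigcup_(i in [set i | FP i `<=` F]) FQ i.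
have f0 : f set0 = set0.
  by rewrite -classical_sets.subset0 => y [i iF _]; have [x /iF] := P0 i.
have fE i : f (FP i) = FQ i.
  by apply/seteqP; split=> [y [j /PQ]|y Qy]; [exact|exists i].
have f_le F G : face P F -> face P G -> (f F `<=` f G <-> F `<=` G).
  move=> /faceP[->|[i ->]] /faceP[->|[j ->]]; rewrite ?f0 ?fE.
  - by split=> _ ? [].
  - by split=> _ ? [].
  - by rewrite !classical_sets.subset0; split=> E; [have := Q0 i|have := P0 i];
      rewrite E => -[].
  - by rewrite PQ.
exists f => //; split.
- move=> F /faceP[->|[i ->]]; rewrite ?f0 ?fE; apply/faceQ; first by left.
  by right; exists i.
- move=> F G /set_mem PF /set_mem PG E.
  by apply/seteqP; split; apply/f_le => //; rewrite E.
- move=> G /faceQ[->|[i ->]].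
    by exists set0 => //; apply/faceP; left.
  by exists (FP i); [apply/faceP; right; exists i|exact: fE].
Qed.

Definition dot n (w : 'I_n -> R) (x : 'rV[R]_n) : R := \sum_i w i * x 0 i.

Lemma dot_is_scalar n (w : 'I_n -> R) : scalar (dot w).
Proof.
move=> a x y; rewrite /dot mulr_sumr -big_split; apply: eq_bigr => i _ /=.
by rewrite !mxE mulrDr mulrCA.
Qed.

HB.instance Definition _ n (w : 'I_n -> R) :=
  GRing.isLinear.Build R 'rV[R]_n R _ (dot w) (dot_is_scalar w).

Lemma scalar_dot n (l : {scalar 'rV[R]_n}) x :
  l x = dot (fun i => l (delta_mx 0 i)) x.
Proof.
rewrite {1}(row_sum_delta x) linear_sum; apply: eq_bigr => i _.
by rewrite linearZ/= mulrC.
Qed.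

(** [M] is the support function of [P]. A valid inequality whose bound differs from [M w] is nowhere
    tight, so it cuts out the empty face. *)
Lemma face_dotP n (P : set 'rV[R]_n) (M : ('I_n -> R) -> R) F :
    (forall w x, P x -> dot w x <= M w) ->
    (forall w, exists2 x, P x & dot w x = M w) ->
  face P F <-> F = set0 \/ exists w, F = P `&` [set x | dot w x = M w].
Proof.
move=> PM Pmax; split=> [[l [c [lc ->]]]|[->|[w ->]]].
- pose w i := l (delta_mx 0 i); have lE x : l x = dot w x := scalar_dot l x.
  have [x Px xM] := Pmax w.
  have [Mc|cM] := eqVneq (M w) c.
    right; exists w; rewrite -Mc.
    by apply/seteqP; split=> y [Py yc]; split=> //; move: yc => /=; rewrite lE.
  left; rewrite -classical_sets.subset0 => y [Py /= yc].
  case/eqP: cM; apply/le_anti; rewrite -{1}xM -lE lc//=.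
  by rewrite -yc lE PM.
- exists (dot (fun=> 0)), 1; split=> [x _|].
    by rewrite /= /dot big1 // => i _; rewrite mul0r.
  apply/seteqP; split=> // x [_ /= /eqP].
  by rewrite /dot big1 ?(eq_sym 0) ?oner_eq0// => i _; rewrite mul0r.
- by exists (dot w), (M w); split=> // x; exact: PM.
Qed.

End Faces.

(** * Sets of bounded size and maximal weight *)

Section OptimalSets.
Context {R : realDomainType} {T : finType}.
Implicit Types (w : T -> R) (S : {set T}) (k m : nat).

Definition weight w S : R := \sum_(i in S) w i.

Definition optimal k w S : Prop :=
  (#|S| <= k)%N /\ forall S', (#|S'| <= k)%N -> weight w S' <= weight w S.

(** Stability under removing, adding or swapping a single element already gives global
    optimality. *)
Lemma optimalP k w S : optimal k w S <->
  [/\ (#|S| <= k)%N,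
      forall i, i \in S -> 0 <= w i,
      (#|S| < k)%N -> forall i, i \notin S -> w i <= 0 &
      forall i j, i \in S -> j \notin S -> w j <= w i].
Proof.
split=> [[Sk Smax]|[Sk Sge0 Sle0 Sle]].
  split=> // [i iS|ltSk i iS|i j iS jS].
  - have := Smax (S :\ i)%SET; rewrite /weight [leRHS](big_setD1 i)//=.
    rewrite lerDr; apply; apply: leq_trans Sk.
    by rewrite subset_leq_card ?subD1set.
  - have := Smax (i |: S)%SET; rewrite /weight big_setU1//=.
    by rewrite gerDr cardsU1 iS; apply.
  - have jS' : j \notin (S :\ i)%SET by rewrite !inE (negPf jS) andbF.
    have := Smax (j |: (S :\ i))%SET.
    rewrite /weight big_setU1//= [leRHS](big_setD1 i)//= lerD2r; apply.
    by rewrite cardsU1 jS' (leq_trans _ Sk)// (cardsD1 i S) iS.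
split=> // S' S'k; rewrite /weight (big_setID S)/= [leRHS](big_setID S')/=.
rewrite finset.setIC lerD2l.
have [Slt|Sge] := ltnP #|S| k.
  apply: (@le_trans _ _ 0).
    by apply: sumr_le0 => i /setDP[_ iS]; apply: Sle0.
  by apply: sumr_ge0 => i /setDP[iS _]; apply: Sge0.
have card_le : (#|S' :\: S| <= #|S :\: S'|)%N.
  rewrite -(leq_add2l #|S :&: S'|) cardsID finset.setIC cardsID.
  exact: leq_trans S'k Sge.
have [SD0|[i0 i0S]] := set_0Vmem (S :\: S')%SET.
  move: card_le; rewrite SD0 cards0 leqn0 cards_eq0 => /eqP ->.
  by rewrite !big_set0.
(* The least weight on [S :\: S'] is nonnegative and bounds every weight on [S' :\: S], which has no
   more elements. *)
case: (@arg_minP _ _ _ i0 [in S :\: S'] w i0S) => i /setDP[iS _] imin.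
apply: (@le_trans _ _ (w i *+ #|S' :\: S|)).
  rewrite -sumr_const; apply: ler_sum => j /setDP[_ jS]; exact: Sle.
apply: (@le_trans _ _ (w i *+ #|S :\: S'|)).
  by apply: ler_wpMn2l => //; apply: Sge0.
by rewrite -sumr_const; apply: ler_sum => j; apply: imin.
Qed.

(** If [S] is too large for [k], dropping an element of least weight suffices. *)
Lemma optimal_down k w S : optimal k.+1 w S ->
  exists2 S' : {set T}, S' \subset S & optimal k w S'.
Proof.
move=> /optimalP[Sk Sge0 Sle0 Sle].
have [Slt|Sge] := leqP #|S| k.
  by exists S => //; apply/optimalP; split=> // ltSk; apply: Sle0; exact: leqW.
have [i0 i0S] : exists i, i \in S.
  by apply/card_gt0P; apply: leq_trans Sge.
case: (@arg_minP _ _ _ i0 [in S] w i0S) => i iS imin.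
have cardD : #|(S :\ i)%SET| = k.
  by move: Sk; rewrite leq_eqVlt ltnNge Sge orbF (cardsD1 i S) iS => /eqP[].
exists (S :\ i)%SET; first exact: subD1set.
apply/optimalP; split; rewrite ?cardD ?ltnn//.
  by move=> j /setD1P[_ /Sge0].
move=> j l /setD1P[_ jS]; rewrite !inE negb_and negbK => /orP[/eqP->|lS].
  exact: imin.
exact: Sle.
Qed.

(** A heaviest outside element is added when some outside weight is positive; otherwise [S] stays
    optimal. *)
Lemma optimal_up k w S : optimal k w S ->
  exists2 S' : {set T}, S \subset S' & optimal k.+1 w S'.
Proof.
move=> /optimalP[Sk Sge0 Sle0 Sle].
have [/existsP[i0 /andP[i0S wi0]]|/existsPn noi] :=
  boolP [exists i, (i \notin S) && (0 < w i)]; last first.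
  exists S => //; apply/optimalP; split=> //; first exact: leqW.
  by move=> _ i iS; move: (noi i); rewrite iS /= -leNgt.
(* An outside element of positive weight forces [S] to be full. *)
have cardS : #|S| = k.
  apply/eqP; rewrite eqn_leq Sk leqNgt; apply/negP => /Sle0/(_ _ i0S).
  by rewrite leNgt wi0.
case: (@arg_maxP _ _ _ i0 [in ~: S] w) => [|i]; first by rewrite inE.
rewrite inE => iS imax.
have wi : 0 < w i by apply: lt_le_trans wi0 (imax _ _); rewrite inE.
have cardU : #|(i |: S)%SET| = k.+1 by rewrite cardsU1 iS cardS.
exists (i |: S)%SET; first exact: finset.subsetUr.
apply/optimalP; split; rewrite ?cardU ?ltnn//.
  by move=> j /setU1P[->|/Sge0//]; rewrite ltW.
move=> j l /setU1P[->|jS]; rewrite !inE negb_or => /andP[_ lS].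
  by apply: imax; rewrite inE.
exact: Sle.
Qed.

(** Greedy argument, descending and ascending from size [k]. Starting at an arbitrary optimal [S]
    lets any such set occur later as a layer of a maximizing parking function. *)
Lemma optimal_chain k w S : optimal k w S ->
  exists f : nat -> {set T},
    [/\ f k = S, forall m, optimal m w (f m) &
        {homo f : m p / (m <= p)%N >-> m \subset p}].
Proof.
move=> Sopt.
have [f [fk fopt fS]] : exists f : nat -> {set T},
    [/\ f k = S, forall m, (m <= k)%N -> optimal m w (f m) &
        forall m, (m < k)%N -> f m \subset f m.+1].
  elim: k S Sopt => [|k IH] S Sopt.
    by exists (fun=> S); split=> // m; rewrite leqn0 => /eqP ->.
  have [S' S'S /IH[f [fk fopt fS]]] := optimal_down Sopt.
  exists (fun m => if (m <= k)%N then f m else S).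
  split=> [|m|m]; rewrite ?ltnn//.
    by rewrite leq_eqVlt ltnS; case: ifP => [/fopt//|_]; rewrite orbF => /eqP->.
  rewrite ltnS => mk; rewrite mk; case: ltnP => [/fS//|km].
  have -> : m = k by apply/eqP; rewrite eqn_leq mk.
  by rewrite fk.
(* The implication sits under the existential so that a total function [next] can be chosen. *)
have next_ex (mS : nat * {set T}) : exists S', optimal mS.1 w mS.2 ->
    mS.2 \subset S' /\ optimal mS.1.+1 w S'.
  have [/optimal_up[S' ? ?]|?] := pselect (optimal mS.1 w mS.2);
    last by exists S.
  by exists S'.
have [next nextP] := choice next_ex.
pose g := fix g p := if p is q.+1 then next ((k + q)%N, g q) else S.
have gopt p : optimal (k + p) w (g p).
  elim: p => [|p IH]; first by rewrite addn0.
  by rewrite addnS; have [] := nextP ((k + p)%N, g p) IH.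
have gS p : g p \subset g p.+1 by have [] := nextP ((k + p)%N, g p) (gopt p).
exists (fun m => if (m <= k)%N then f m else g (m - k)%N).
split=> [|m|]; first by rewrite leqnn.
  by case: leqP => [/fopt//|/ltnW km]; have := gopt (m - k)%N; rewrite subnKC.
apply: homo_leq => [m|p q m|m]; [exact: subxx|exact: fintype.subset_trans|].
case: (ltngtP m k) => [mk|km|->]; first exact: fS.
- by rewrite subSn ?(ltnW km).
- by rewrite subSn // subnn fk; apply: (gS 0).
Qed.

(** The default 0 is the weight of the empty set, which is always admissible. *)
Definition max_weight k w : R :=
  \big[Num.max/0]_(S : {set T} | (#|S| <= k)%N) weight w S.

Lemma weight_le_max k w S : (#|S| <= k)%N -> weight w S <= max_weight k w.
Proof. by move=> Sk; apply: le_bigmax_cond. Qed.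

Lemma optimal_max_weightP k w S : (#|S| <= k)%N ->
  optimal k w S <-> weight w S = max_weight k w.
Proof.
move=> Sk; split=> [[_ Smax]|SE]; last first.
  by split=> // S'; rewrite SE; exact: weight_le_max.
apply/le_anti; rewrite weight_le_max//=; apply: bigmax_le => //.
by have := Smax finset.set0; rewrite cards0 /weight big_set0; apply.
Qed.

Lemma optimal0 w : optimal 0 w finset.set0.
Proof.
by split=> [|S]; rewrite ?cards0// leqn0 cards_eq0 => /eqP ->.
Qed.

End OptimalSets.

(* By [optimalP], the inclusion of all the families of optimal sets only
   depends on the signs of the weights and on the order of the nonnegative
   ones. *)
Lemma optimal_subP (R : realDomainType) (T : finType) (w w' : T -> R) :
  (forall k (S : {set T}), (k <= #|T|)%N -> optimal k w S -> optimal k w' S) <->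
  [/\ forall i, 0 <= w i -> 0 <= w' i, forall i, w i <= 0 -> w' i <= 0 &
      forall i j, 0 <= w i -> w j <= w i -> w' j <= w' i].
Proof.
split=> [H|[ge0 le0 le] k S kT /optimalP[Sk Sge0 Sle0 Sle]]; last first.
  apply/optimalP; split=> // [i /Sge0/ge0//|ltSk i iS|i j iS jS].
    by apply: le0; apply: Sle0.
  by apply: le; [exact: Sge0|exact: Sle].
have {}H k S kT Sopt := (optimalP _ _ _).1 (H k S kT Sopt).
split=> [i wi|i wi|i j wi wji].
(* With [k = #|T|] the size bound is vacuous, and all elements of nonnegative weight form an optimal
   set. *)
- pose S := [set l | 0 <= w l]%SET.
  have [|_ + _ _] := H #|T| S (leqnn _); last by apply; rewrite inE.
  apply/optimalP; split=> [|l|_ l|l p]; rewrite ?inE ?max_card// -ltNge.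
    by move=> /ltW.
  by move=> wl /ltW/le_trans; apply.
(* The elements of positive weight are optimal as well. This set misses [i], so it is not full and
   outside weights are nonpositive for [w']. *)
- pose S := [set l | 0 < w l]%SET.
  have [|_ _ + _] := H #|T| S (leqnn _).
    apply/optimalP; split=> [|l|_ l|l p]; rewrite ?inE ?max_card// -?leNgt//.
      by move/ltW.
    by move=> wl wp; apply: le_trans wp (ltW wl).
  move=> /(_ _ i); rewrite inE -leNgt; apply=> //.
  have : S \proper [set: T]%SET.
    apply/properP; split; first exact: finset.subsetT.
    by exists i; rewrite // inE -leNgt.
  by move/proper_card; rewrite cardsT.
- have [->//|ij] := eqVneq i j.
  (* With [k = #|S|] the set is full, hence optimal even if the omitted [j] has positive weight; the
     exchange condition then compares [i] with [j]. *)
  pose S := [set l | (w i <= w l) && (l != j)]%SET.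
  have [|_ _ _ +] := H #|S| S (max_card _); last first.
    by apply; rewrite !inE ?lexx ?ij// eqxx andbF.
  apply/optimalP; split=> [|l||l p]; rewrite ?ltnn// !inE.
    by move=> /andP[/(le_trans wi)].
  move=> /andP[wl _]; rewrite negb_and -ltNge negbK => /orP[/ltW wp|/eqP ->].
    exact: le_trans wp wl.
  exact: le_trans wji wl.
Qed.

(** * Counting lemmas *)

(** The predicate [p] holds on an initial segment contained in [[0, N)], and the sum is the length
    of that segment. *)
Lemma sum_antitone_ltn (p : nat -> bool) (N s : nat) :
    {homo p : i j / (i <= j)%N >-> j ==> i} -> ~~ p N ->
  (s < \sum_(i < N) p i)%N = p s.
Proof.
move=> pdec pN; rewrite -(big_mkord predT (fun i => nat_of_bool (p i))).
apply/idP/idP => [|ps].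
  apply: contraLR => ps; rewrite -leqNgt.
  have [Ns|sN] := leqP N s.
    apply: (@leq_trans (\sum_(0 <= i < N) 1)).
      by apply: leq_sum => i _; case: (p i).
    by rewrite sum_nat_const_nat muln1 subn0.
  rewrite (big_cat_nat (n := s))// ?(ltnW sN)//= [X in (_ + X)%N]big_nat_cond.
  rewrite [X in (_ + X)%N]big1 ?addn0 => [|i /andP[/andP[si _] _]].
    apply: (@leq_trans (\sum_(0 <= i < s) 1)).
      by apply: leq_sum => i _; case: (p i).
    by rewrite sum_nat_const_nat muln1 subn0.
  by apply/eqP; rewrite eqb0; apply: contra ps; apply/implyP; exact: pdec.
have sN : (s < N)%N.
  by rewrite ltnNge; apply: contra pN => /pdec; rewrite ps => /implyP; apply.
rewrite (big_cat_nat (n := s.+1))//=; apply: leq_trans (leq_addr _ _).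
rewrite -[X in (X <= _)%N]subn0 -[X in (X <= _)%N]muln1 -sum_nat_const_nat.
rewrite big_nat_cond [leqRHS]big_nat_cond; apply: leq_sum => i.
by rewrite andbT ltnS => /andP[_ /pdec]; rewrite ps /= => ->.
Qed.

Lemma count_tnth n (T : Type) (P : pred T) (t : n.-tuple T) :
  count P t = #|[set i | P (tnth t i)]%SET|.
Proof.
rewrite -[in LHS](map_tnth_enum t) count_map cardsE cardE -size_filter.
rewrite /enum_mem -filter_predI; congr size; apply: eq_filter => i.
by rewrite /= !inE andbT.
Qed.

(** * Layers of parking functions *)

Section ParkingFunctions.
Context {n : nat} (b : 'I_n -> nat).
Implicit Types beta : n.-tuple nat.

Definition threshold (j : 'I_n) : nat := \sum_(i < n | (i <= j)%N) b i.

(** Up to an index shift, this is the partition conjugate to the thresholds. *)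
Definition capacity (s : nat) : nat := #|[set j | (s < threshold j)%N]%SET|.

Definition layer beta (s : nat) : {set 'I_n} := [set i | (s < tnth beta i)%N].

Lemma threshold_le j : (threshold j <= \sum_i b i)%N.
Proof. by rewrite [leqRHS](bigID (fun i : 'I_n => (i <= j)%N)) leq_addr. Qed.

Lemma threshold_homo : {homo threshold : i j / (i <= j)%N}.
Proof.
move=> i j ij; rewrite /threshold [leqRHS](bigID (fun k : 'I_n => (k <= i)%N))/=.
rewrite (eq_bigl (fun k : 'I_n => (k <= j)%N && (k <= i)%N)) ?leq_addr// => k.
by rewrite andb_idl// => /leq_trans; apply.
Qed.

Lemma capacity_anti : {homo capacity : s r / (s <= r)%N >-> (r <= s)%N}.
Proof.
move=> s r sr; apply/subset_leq_card/fintype.subsetP => j.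
by rewrite !inE; apply: leq_ltn_trans.
Qed.

Lemma capacity_large s : (\sum_i b i <= s)%N -> capacity s = 0%N.
Proof.
move=> bs; apply/eqP; rewrite cards_eq0; apply/eqP/setP => j; rewrite !inE.
by apply/negbTE; rewrite -leqNgt (leq_trans (threshold_le j)).
Qed.

(** The number of entries above a level does not depend on their order, so layers remove the sorting
    from the definition. *)
Lemma parking_functionP beta : parking_function b beta <->
  (forall i, 0 < tnth beta i)%N /\
  (forall s, #|layer beta s| <= capacity s)%N.
Proof.
have card_layer s : #|layer beta s| =
    #|[set i : 'I_n | (s < nth 0 (sort leq beta) i)%N]%SET|.
  pose sbeta := [tuple of sort leq beta].
  rewrite /layer -(count_tnth (fun m => s < m)%N beta).
  have -> : count (fun m => s < m)%N beta = count (fun m => s < m)%N sbeta.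
    by rewrite /= count_sort.
  by rewrite count_tnth; apply: eq_card => i; rewrite !inE (tnth_nth 0%N).
split=> -[beta0 betab]; split=> //.
  move=> s; rewrite card_layer; apply/subset_leq_card/fintype.subsetP => j.
  by rewrite !inE => /leq_trans; apply; apply: betab.
move=> i; rewrite leqNgt; apply/negP => ilt.
(* At level [threshold i] the capacity counts only positions beyond [i], while all sorted entries
   from position [i] on exceed that level. *)
have := betab (threshold i); rewrite card_layer leqNgt => /negP; apply.
apply: (@leq_trans #|[set j : 'I_n | (i <= j)%N]%SET|).
  apply/proper_card/properP; split; last by exists i; rewrite !inE ?ltnn.
  apply/fintype.subsetP => j; rewrite !inE; apply: contraTT.
  by rewrite -ltnNge -leqNgt => /ltnW/threshold_homo.
apply/subset_leq_card/fintype.subsetP => j; rewrite !inE => ij.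
apply: leq_trans ilt _; apply: (sorted_leq_nth leq_trans leqnn) => //.
- exact: (sort_sorted leq_total).
- by rewrite inE size_sort size_tuple.
- by rewrite inE size_sort size_tuple.
Qed.

Lemma parking_layer_large beta s : parking_function b beta ->
  (\sum_i b i <= s)%N -> layer beta s = finset.set0.
Proof.
move=> /parking_functionP[_ /(_ s)] + bs.
by rewrite capacity_large// leqn0 cards_eq0 => /eqP.
Qed.

(** An entry counts the layers containing its index: the full layer 0 gives the 1, and layers from
    [\sum_i b i] on are empty. *)
Lemma parking_layer_sum beta i : parking_function b beta ->
  tnth beta i = (1 + \sum_(s < \sum_i b i) (i \in layer beta s.+1))%N.
Proof.
move=> pb; have /parking_functionP[/(_ i) beta0 _] := pb.
rewrite -[LHS](prednK beta0) add1n; congr _.+1.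
suff lt_iff s : (s < \sum_(s < \sum_i b i) (i \in layer beta s.+1))%N
    = (s < (tnth beta i).-1)%N.
  by apply/eqP; rewrite eqn_leq leqNgt -lt_iff ltnn leqNgt lt_iff ltnn.
rewrite (sum_antitone_ltn (p := fun s => i \in layer beta s.+1)).
- by rewrite inE -[RHS]ltnS prednK.
- move=> r t rt; rewrite !inE; apply/implyP; exact: leq_ltn_trans.
- by rewrite (parking_layer_large pb) ?inE.
Qed.

(** The sets [f (capacity s)] shrink as [s] grows, so counting memberships produces a list with
    exactly these layers. *)
Lemma layered_parking_function (f : nat -> {set 'I_n}) :
    (forall k, (#|f k| <= k)%N) ->
    {homo f : k m / (k <= m)%N >-> k \subset m} ->
    (forall j, 0 < threshold j)%N ->
  exists2 beta, parking_function b beta &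
    forall s, layer beta s.+1 = f (capacity s.+1).
Proof.
move=> fcard fmono c0; pose N := (\sum_i b i)%N.
pose beta := [tuple (1 + \sum_(s < N) (i \in f (capacity s.+1)))%N | i < n].
have layerE s : layer beta s.+1 = f (capacity s.+1).
  apply/setP => i; rewrite inE tnth_mktuple add1n ltnS.
  apply: (sum_antitone_ltn (p := fun s => i \in f (capacity s.+1))).
    move=> r t rt; apply/implyP.
    by move/fintype.subsetP: (fmono _ _ (capacity_anti (rt : r < t.+1)%N)); apply.
  have := fcard 0%N; rewrite capacity_large// leqn0 cards_eq0 => /eqP ->.
  by rewrite inE.
exists beta => //; apply/parking_functionP; split=> [i|[|s]].
- by rewrite tnth_mktuple.
(* Layer 0 is full, so it fits only because every threshold is positive. *)
- apply/subset_leq_card/fintype.subsetP => j _; rewrite inE; exact: c0.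
- by rewrite layerE.
Qed.

End ParkingFunctions.

(** * Faces of the parking-function polytope *)

Section ParkingPolytope.
Context {R : realType} {n : nat} (b : 'I_n -> nat).
Context (hn : (0 < n)%N) (b_gt0 : forall i, (0 < b i)%N).
Implicit Types (beta : n.-tuple nat) (w : 'I_n -> R).

Definition parking_point beta : 'rV[R]_n := \row_i (tnth beta i)%:R.

(** The support function of the polytope: the first sum comes from the full layer 0, and every other
    layer contributes its maximal weight. *)
Definition parking_support w : R :=
  \sum_i w i + \sum_(s < \sum_i b i) max_weight (capacity b s.+1) w.

Definition parking_face w : set 'rV[R]_n :=
  parking_polytope R b `&` [set x | dot w x = parking_support w].

Lemma dot_parking_point w beta : parking_function b beta ->
  dot w (parking_point beta) =
    \sum_i w i + \sum_(s < \sum_i b i) weight w (layer beta s.+1).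
Proof.
move=> pb; rewrite /dot /weight.
under [X in _ = _ + X]eq_bigr do rewrite big_mkcond/=.
rewrite exchange_big -big_split; apply: eq_bigr => i _ /=.
rewrite mxE (parking_layer_sum i pb) natrD mulrDr mulr1 natr_sum mulr_sumr.
by congr (_ + _); apply: eq_bigr => s _; case: ifP; rewrite ?mulr1 ?mulr0.
Qed.

Lemma dot_parking_point_le w beta : parking_function b beta ->
  dot w (parking_point beta) <= parking_support w.
Proof.
move=> pb; rewrite dot_parking_point// lerD2l; apply: ler_sum => s _.
by apply: weight_le_max; have /parking_functionP[_] := pb; apply.
Qed.

Lemma dot_parking_point_eq w beta : parking_function b beta ->
  dot w (parking_point beta) = parking_support w <->
  forall s, optimal (capacity b s.+1) w (layer beta s.+1).
Proof.
move=> pb; have /parking_functionP[_ layer_le] := pb.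
rewrite dot_parking_point//.
have := @leif_sum R _ predT
  (fun s : 'I__ => weight w (layer beta s.+1) == max_weight (capacity b s.+1) w)
  (fun s : 'I_(\sum_i b i) => weight w (layer beta s.+1))
  (fun s => max_weight (capacity b s.+1) w).
case=> [s _|_ eqE]; first exact/leif_eq/weight_le_max.
split=> [/addrI/eqP|opt].
  (* Levels beyond the range of the sum have capacity 0 and an empty layer, which is optimal. *)
  rewrite eqE => /forallP/= opt s; have [bs|sb] := leqP (\sum_i b i) s.
    rewrite capacity_large ?leqW// (parking_layer_large pb) ?leqW//.
    exact: optimal0.
  by apply/optimal_max_weightP => //; apply/eqP; apply: (opt (Ordinal sb)).
congr (_ + _); apply/eqP; rewrite eqE; apply/forallP => s /=.
by apply/eqP/optimal_max_weightP.
Qed.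

(** A chain of optimal sets through [S], read along the capacities, gives one parking function
    maximizing all layers at once. *)
Lemma optimal_parking_function w k (S : {set 'I_n}) : optimal k w S ->
  exists beta, [/\ parking_function b beta,
    forall s, optimal (capacity b s.+1) w (layer beta s.+1) &
    forall s, capacity b s.+1 = k -> layer beta s.+1 = S].
Proof.
move=> /optimal_chain[f [fk fopt fmono]].
have [||j|beta pb layerE] := layered_parking_function (b := b) (f := f) => //.
- by move=> m; have [] := fopt m.
- by rewrite /threshold (bigD1 j)//= ltn_addr.
exists beta; split=> // s; first by rewrite layerE.
by rewrite layerE => ->.
Qed.

Lemma parking_point_in beta : parking_function b beta ->
  parking_polytope R b (parking_point beta).
Proof. by move=> pb; apply: sub_convex_hull; exists beta. Qed.

Lemma parking_support_ge w x : parking_polytope R b x ->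
  dot w x <= parking_support w.
Proof.
apply: (convex_hull_le (l := dot w)) => _ [beta pb <-].
exact: dot_parking_point_le.
Qed.

Lemma parking_support_attained w :
  exists2 x, parking_polytope R b x & dot w x = parking_support w.
Proof.
have [beta [pb opt _]] := optimal_parking_function (optimal0 w).
exists (parking_point beta); first exact: parking_point_in.
exact/dot_parking_point_eq.
Qed.

Lemma parking_faceP F : face (parking_polytope R b) F <->
  F = classical_sets.set0 \/ exists w, F = parking_face w.
Proof.
apply: face_dotP => w; first exact: parking_support_ge.
exact: parking_support_attained.
Qed.

Lemma parking_face_neq0 w : parking_face w !=set0.
Proof. by have [x Px xE] := parking_support_attained w; exists x. Qed.

(** Every optimal set of an occurring size is a layer of some parking function in the face of [w];
    conversely, inclusion is checked on parking functions. *)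
Lemma parking_face_sub w w' : parking_face w `<=` parking_face w' <->
  forall s (S : {set 'I_n}),
    optimal (capacity b s.+1) w S -> optimal (capacity b s.+1) w' S.
Proof.
split=> [sub s S /optimal_parking_function[beta [pb opt layerE]]|H x [Px xE]].
  rewrite -(layerE s)//; apply: (dot_parking_point_eq w' pb).1.
  apply: (sub _ _).2; split; first exact: parking_point_in.
  exact/dot_parking_point_eq.
split=> //; apply: convex_hull_face_sub Px xE.
- by move=> _ [beta pb <-]; exact: dot_parking_point_le.
- by move=> _ [beta pb <-]; exact: dot_parking_point_le.
- move=> _ [beta pb <-] /(dot_parking_point_eq w pb) opt.
  by apply/(dot_parking_point_eq w' pb) => s; apply: H.
Qed.

(** Thresholds increase strictly since all [b i] are positive, so no value below [n] is skipped. The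
    value [n] needs the first threshold to exceed 1. *)
Lemma capacity_range k : (exists s, capacity b s.+1 = k) <->
  (k < n)%N \/ k = n /\ (1 < b (Ordinal hn))%N.
Proof.
have threshold0 : threshold b (Ordinal hn) = b (Ordinal hn).
  rewrite /threshold (big_pred1 (Ordinal hn))// => i.
  by rewrite leqn0.
have threshold_lt i j : (threshold b i < threshold b j)%N = (i < j)%N.
  apply/idP/idP.
    by apply: contraTT; rewrite -!leqNgt; apply: threshold_homo.
  move=> ij; rewrite /threshold [ltnRHS](bigD1 j)//= -add1n leq_add//.
  rewrite [leqRHS](bigID (fun k : 'I_n => (k <= i)%N))/=.
  rewrite (eq_bigl (fun k : 'I_n => [&& (k <= j)%N, k != j & (k <= i)%N]))/=.
    by under [X in (_ <= X + _)%N]eq_bigl do rewrite -andbA; exact: leq_addr.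
  move=> l; case: (leqP l i) => [li|]; last by rewrite !andbF.
  rewrite (leq_trans li (ltnW ij)) andbT -val_eqE/= neq_ltn.
  by rewrite (leq_ltn_trans li ij).
split=> [[s <-]|[kn|[-> b1]]].
- have [lt|ge] := ltnP (capacity b s.+1) n; [by left|right].
  have capE : capacity b s.+1 = n.
    by apply/eqP; rewrite eqn_leq ge andbT -[leqRHS]card_ord max_card.
  split=> //; have /setP/(_ (Ordinal hn)) :
      [set j | (s.+1 < threshold b j)%N]%SET = [set: 'I_n]%SET.
    by apply/eqP; rewrite eqEcard finset.subsetT cardsT card_ord.
  by rewrite !inE threshold0; apply: leq_ltn_trans.
- have jn : (n.-1 - k < n)%N by rewrite (leq_ltn_trans (leq_subr _ _)) ?prednK.
  (* At the level [threshold j], only the indices beyond [j] count; [j = n.-1 - k] leaves exactly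
     [k] of them. *)
  exists (threshold b (Ordinal jn)).-1; rewrite prednK; last first.
    by rewrite (leq_trans (b_gt0 (Ordinal hn)))// -threshold0 threshold_homo.
  rewrite /capacity -sum1_card.
  rewrite (eq_bigl (fun j : 'I_n => true && (n.-1 - k < j)%N)) => [|j]; last first.
    by rewrite inE threshold_lt.
  rewrite -(big_geq_mkord (n.-1 - k).+1 n predT (fun=> 1%N)).
  rewrite sum_nat_const_nat muln1.
  by rewrite subnS predn_sub subKn// -ltnS prednK.
- exists 0%N; rewrite /capacity -[RHS]card_ord -cardsT; apply: eq_card => j.
  by rewrite !inE (leq_trans b1)// -threshold0 threshold_homo.
Qed.

Lemma parking_face_sub_optimal w w' : parking_face w `<=` parking_face w' <->
  forall k (S : {set 'I_n}), (k < n)%N \/ k = n /\ (1 < b (Ordinal hn))%N ->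
    optimal k w S -> optimal k w' S.
Proof.
rewrite parking_face_sub; split=> H => [k S /capacity_range[s <-]|s S].
  exact: H.
by apply: H; apply/capacity_range; exists s.
Qed.

End ParkingPolytope.

(** * Faces of Minkowski sums of simplices *)

Section SimplexSums.
Context {R : realType} {m : nat} (B : {set {set 'I_m.+1}})
  (y : {set 'I_m.+1} -> R).
Context (B_neq0 : forall I, I \in B -> I != finset.set0)
  (y_gt0 : forall I, I \in B -> 0 < y I).
Implicit Types (u : 'I_m.+1 -> R) (I : {set 'I_m.+1}).

Definition maximizes u I i : Prop :=
  i \in I /\ forall j, j \in I -> u j <= u i.

(** The default 0 is reached only for empty [I], which [B_neq0] excludes from [B]. *)
Definition max_on u I : R :=
  if [pick i in I | [forall j in I, u j <= u i]] is Some i then u i else 0.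

Lemma max_onP u I : I \in B ->
  (exists i, maximizes u I i) /\
  (forall i, i \in I -> maximizes u I i <-> u i = max_on u I).
Proof.
move=> /B_neq0/set0Pn[i0 i0I]; rewrite /max_on.
case: pickP => [i /andP[iI /forall_inP imax]|none]; last first.
  case: (@arg_maxP _ _ _ i0 [in I] u i0I) => i iI imax.
  by have := none i; rewrite iI => /forall_inP[].
split=> [|j jI]; first by exists i.
split=> [[_ jmax]|uji]; last by split=> // l lI; rewrite uji imax.
by apply/le_anti; rewrite imax//= jmax.
Qed.

Lemma le_max_on u I i : I \in B -> i \in I -> u i <= max_on u I.
Proof.
move=> IB iI; have [[j jmax] maxE] := max_onP u IB.
by rewrite -(maxE j jmax.1).1// jmax.2.
Qed.

Lemma dot_delta u i : dot u (delta_mx 0 i) = u i.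
Proof.
rewrite /dot (bigD1 i)//= big1 => [|j ji]; first by rewrite mxE !eqxx mulr1 addr0.
by rewrite mxE (negPf ji) andbF mulr0.
Qed.

Lemma simplex_vertex I i : i \in I -> simplex I (delta_mx 0 i : 'rV[R]_m.+1).
Proof. by move=> iI; apply: sub_convex_hull; exists i. Qed.

Lemma simplex_le u I x : I \in B -> simplex I x -> dot u x <= max_on u I.
Proof.
move=> IB; apply: (convex_hull_le (l := dot u)) => _ [i iI <-].
by rewrite /= dot_delta le_max_on.
Qed.

Definition simplex_sum_support u : R := \sum_(I in B) y I * max_on u I.

Definition simplex_sum_face u : set 'rV[R]_m.+1 :=
  simplex_sum B y `&` [set x | dot u x = simplex_sum_support u].

Lemma dot_simplex_sum_le u (z : {set 'I_m.+1} -> 'rV[R]_m.+1) :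
    (forall I, I \in B -> simplex I (z I)) ->
  dot u (\sum_(I in B) y I *: z I) <= simplex_sum_support u.
Proof.
move=> zB; rewrite linear_sum/=; apply: ler_sum => I IB.
by rewrite linearZ/= ler_pM2l ?y_gt0//; exact: simplex_le (zB I IB).
Qed.

(** Each summand is bounded by its own maximum, so equality of the sums forces equality termwise,
    and positive [y I] cancel. *)
Lemma dot_simplex_sum_eq u (z : {set 'I_m.+1} -> 'rV[R]_m.+1) :
    (forall I, I \in B -> simplex I (z I)) ->
  dot u (\sum_(I in B) y I *: z I) = simplex_sum_support u <->
  forall I, I \in B -> dot u (z I) = max_on u I.
Proof.
move=> zB; rewrite linear_sum/= /simplex_sum_support.
under eq_bigr do rewrite linearZ/=.
have [I IB|_ eqE] := @leif_sum R _ (mem B)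
  (fun I => y I * dot u (z I) == y I * max_on u I)
  (fun I => y I * dot u (z I)) (fun I => y I * max_on u I).
  by apply/leif_eq; rewrite ler_pM2l ?y_gt0//; exact: simplex_le (zB I IB).
split=> [/eqP|zmax].
  rewrite eqE => /forall_inP H I IB; have /eqP := H I IB.
  by apply/mulfI; rewrite gt_eqF ?y_gt0.
by apply/eqP; rewrite eqE; apply/forall_inP => I IB; rewrite zmax.
Qed.

Lemma simplex_sum_vertex u (v : {set 'I_m.+1} -> 'I_m.+1) :
    (forall I, I \in B -> maximizes u I (v I)) ->
  simplex_sum_face u (\sum_(I in B) y I *: delta_mx 0 (v I)).
Proof.
move=> vmax; have zB I : I \in B -> simplex I (delta_mx 0 (v I) : 'rV[R]_m.+1).
  by move=> /vmax[vI _]; exact: simplex_vertex.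
split; first by exists (fun I => delta_mx 0 (v I)).
apply/(@dot_simplex_sum_eq u (fun I => delta_mx 0 (v I))) => // I IB.
rewrite dot_delta; exact: ((max_onP u IB).2 _ (vmax I IB).1).1 (vmax I IB).
Qed.

Lemma maximizes_choice u :
  exists v, forall I, I \in B -> maximizes u I (v I).
Proof.
suff : forall I, exists i, I \in B -> maximizes u I i.
  by move=> /choice[v vP]; exists v.
move=> I; have [IB|_] := boolP (I \in B).
  by have [[i imax] _] := max_onP u IB; exists i.
by exists ord0.
Qed.

Lemma simplex_sum_face_sub u u' :
  simplex_sum_face u `<=` simplex_sum_face u' <->
  forall I i, I \in B -> maximizes u I i -> maximizes u' I i.
Proof.
split=> [sub I i IB imax|H _ [[z zB ->] /= uE]].
  have [v vmax] := maximizes_choice u.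
  (* Only the vertex chosen in the summand [I] is changed to [i]; the resulting point still lies in
     the face of [u]. *)
  pose v' J := if J == I then i else v J.
  have v'max J : J \in B -> maximizes u J (v' J).
    by rewrite /v'; case: eqVneq => [->|_ /vmax].
  have [_ /=] := sub _ (simplex_sum_vertex v'max).
  move/(@dot_simplex_sum_eq u' (fun I => delta_mx 0 (v' I))).
  move=> /(_ _ I IB); rewrite dot_delta /v' eqxx => E.
  apply/((max_onP u' IB).2 _ imax.1)/E => J /v'max[vJ _].
  exact: simplex_vertex.
split; first by exists z.
move/(dot_simplex_sum_eq u zB): uE => zmax.
apply/(dot_simplex_sum_eq u' zB) => I IB.
apply: (convex_hull_face_sub (l := dot u) (l' := dot u')) (zB I IB) (zmax I IB).
- by move=> _ [i iI <-] /=; rewrite dot_delta le_max_on.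
- by move=> _ [i iI <-] /=; rewrite dot_delta le_max_on.
- move=> _ [i iI <-] /=; rewrite !dot_delta.
  by move=> /((max_onP u IB).2 i iI)/(H _ _ IB)/((max_onP u' IB).2 i iI).
Qed.

Lemma face_simplex_sumP F : face (simplex_sum B y) F <->
  F = classical_sets.set0 \/ exists u, F = simplex_sum_face u.
Proof.
apply: face_dotP => [u _ [z zB ->]|u]; first exact: dot_simplex_sum_le.
have [v vmax] := maximizes_choice u.
by have [? ?] := simplex_sum_vertex vmax; eexists; eauto.
Qed.

Lemma simplex_sum_face_neq0 u : simplex_sum_face u !=set0.
Proof.
have [v vmax] := maximizes_choice u.
by eexists; exact: simplex_sum_vertex vmax.
Qed.

End SimplexSums.

(** * Linear forms on the stellohedron *)

Section Stellohedron.
Context {R : realType} {n : nat}.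
Implicit Types (I : {set 'I_n.+1}) (u : 'I_n.+1 -> R).

Lemma stellohedron_building_setP I : I \in stellohedron_building_set n <->
  ord_max \in I \/ exists2 i : 'I_n.+1, i != ord_max & I = [set i]%SET.
Proof.
split=> [/setUP[/imsetP[i]|/imsetP[T _ ->]]|[maxI|[i i_max ->]]].
- by rewrite !inE => i_max ->; right; exists i.
- by left; rewrite setU11.
- apply/setUP; right; apply/imsetP; exists (I :\ ord_max)%SET.
    rewrite inE; apply/fintype.subsetP => j; rewrite !inE => /andP[]//.
  by rewrite finset.setD1K.
- by apply/setUP; left; apply/imsetP; exists i; rewrite ?inE.
Qed.

Lemma stellohedron_building_set_neq0 I :
  I \in stellohedron_building_set n -> I != finset.set0.
Proof.
move=> /stellohedron_building_setP IB; apply/set0Pn.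
by case: IB => [maxI|[i _ ->]]; [exists ord_max|exists i; rewrite inE].
Qed.

(* The sum of the coordinates is constant on the stellohedron, so a linear form
   may be normalized to have coefficient 0 at the last coordinate. *)
Definition reduced_weight u (i : 'I_n) : R := u (lift ord_max i) - u ord_max.

Lemma reduced_weight_surj (w : 'I_n -> R) : exists u, w = reduced_weight u.
Proof.
exists (fun j => if unlift ord_max j is Some i then w i else 0).
by apply/funext => i; rewrite /reduced_weight liftK unlift_none subr0.
Qed.

(** By [optimal_subP] the right side concerns signs and the order of nonnegative reduced weights.
    Pairs and triples containing [ord_max] detect these data. *)
Lemma maximizes_stellohedronP u u' :
  (forall I i, I \in stellohedron_building_set n ->
    maximizes u I i -> maximizes u' I i) <->
  (forall k (S : {set 'I_n}), (k <= #|'I_n|)%N ->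
    optimal k (reduced_weight u) S -> optimal k (reduced_weight u') S).
Proof.
split=> [H|/optimal_subP[ge0 le0 le] I i].
  have {}H I i : ord_max \in I -> maximizes u I i -> maximizes u' I i.
    by move=> maxI; apply: H; apply/stellohedron_building_setP; left.
  apply/optimal_subP; rewrite /reduced_weight; split=> [i|i|i j].
  - rewrite !subr_ge0 => ui.
    have [||_] := H [set ord_max; lift ord_max i]%SET (lift ord_max i).
    + by rewrite !inE eqxx.
    + by split=> [|j]; rewrite !inE ?eqxx ?orbT// => /orP[]/eqP ->.
    + by apply; rewrite !inE eqxx.
  - rewrite !subr_le0 => ui.
    have [||_] := H [set ord_max; lift ord_max i]%SET ord_max.
    + by rewrite !inE eqxx.
    + by split=> [|j]; rewrite !inE ?eqxx ?orbT// => /orP[]/eqP ->.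
    + by apply; rewrite !inE eqxx orbT.
  - rewrite subr_ge0 !lerD2r => ui uji.
    have [||_] :=
      H [set ord_max; lift ord_max i; lift ord_max j]%SET (lift ord_max i).
    + by rewrite !inE eqxx.
    + by split=> [|l]; rewrite !inE ?eqxx ?orbT// => /orP[/orP[]|]/eqP ->.
    + by apply; rewrite !inE eqxx orbT.
(* A singleton imposes no condition, as every form is maximal at its only vertex. *)
move=> /stellohedron_building_setP[maxI|[p _ ->]]; last first.
  by move=> [+ _]; rewrite inE => /eqP ->; split=> [|j]; rewrite inE// => /eqP->.
(* Since [ord_max] lies in [I], a maximizer [i] other than [ord_max] has nonnegative reduced weight,
   as the order comparison requires. *)
move=> [iI imax]; split=> // j jI; have := imax _ jI; have := imax _ maxI.
case: (unliftP ord_max i) => [i' ->|->];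
  case: (unliftP ord_max j) => [j' ->|->] //.
- move: (le i' j') => {le}; rewrite /reduced_weight subr_ge0 !lerD2r => + ui uj.
  exact.
- by move: (ge0 i'); rewrite /reduced_weight !subr_ge0 => + /[swap] _.
- by move: (le0 j'); rewrite /reduced_weight !subr_le0 => + _.
Qed.

End Stellohedron.

(** * Comparison of the face preorders in the two cases *)

Theorem corollary3p14 (R : realType) (n : nat) (hn : (0 < n)%N)
    (b : 'I_n -> nat) (hb : forall i, (0 < b i)%N) :
  (b (Ordinal hn) = 1%N ->
     combinatorially_equivalent (parking_polytope R b)
       (classical_parking_polytope R n)) /\
  ((2 <= b (Ordinal hn))%N ->
     forall St : set 'rV[R]_n.+1, stellohedron St ->
       combinatorially_equivalent (parking_polytope R b) St).
Proof.
have ones_gt0 : forall i : 'I_n, (0 < 1)%N by [].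
split=> [b1|b2 _ [y y_gt0 ->]].
  apply: (combinatorially_equivalent_of_preorder
    (parking_faceP hb) (parking_faceP ones_gt0)
    (parking_face_neq0 hb) (parking_face_neq0 ones_gt0)) => w w'.
  (* Both first entries equal 1, so the admissible sizes [k] agree. *)
  by rewrite (parking_face_sub_optimal hn hb) b1 parking_face_sub_optimal.
(* Both families are indexed by forms on the larger space; [reduced_weight] is surjective, so no
   face of the parking polytope is missed. *)
apply: (@combinatorially_equivalent_of_preorder _ _ _ _ _ _
  (fun u => parking_face b (reduced_weight u))
  (simplex_sum_face (stellohedron_building_set n) y)).
- move=> F; rewrite (parking_faceP hb).
  split=> -[->|[w ->]]; [by left| |by left|].
    by right; have [u ->] := reduced_weight_surj w; exists u.
  by right; exists (reduced_weight w).
- by apply: face_simplex_sumP => //; exact: stellohedron_building_set_neq0.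
- by move=> u; apply: parking_face_neq0.
- by apply: simplex_sum_face_neq0 => //; exact: stellohedron_building_set_neq0.
move=> u u'; rewrite (parking_face_sub_optimal hn hb).
rewrite simplex_sum_face_sub//; last first.
  exact: stellohedron_building_set_neq0.
rewrite maximizes_stellohedronP card_ord; split=> H k S kn; apply: H.
  (* The size [k = n] is admissible because the first entry of [b] is at least 2. *)
  by move: kn; rewrite leq_eqVlt => /predU1P[->|]; [right|left].
by case: kn => [/ltnW|[->]].
Qed.
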